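(* Let $(X,\mathcal{B},\mathbf{b})$ be a coarse proximity space. Let $\phi$ be the relation on the power set of $X$ defined as follows: $A\,\phi\,B$ if and only if both of the following hold: (i) for every unbounded $B'\subseteq B$ we have $A\,\mathbf{b}\,B'$; (ii) for every unbounded $A'\subseteq A$ we have $A'\,\mathbf{b}\,B$. Then $\phi$ is a weak asymptotic resemblance on $X$.
   Context: A bornology $\mathcal{B}$ on a set $X$ is a family of subsets of $X$ such that: $\{x\}\in\mathcal{B}$ for all $x\in X$; $A\in\mathcal{B}$ and $B\subseteq A$ imply $B\in\mathcal{B}$; $A,B\in\mathcal{B}$ implies $A\cup B\in\mathcal{B}$. Elements of $\mathcal{B}$ are called bounded; subsets of $X$ not in $\mathcal{B}$ are called unbounded. A coarse proximity space is a triple $(X,\mathcal{B},\mathbf{b})$ where $X$ is a set, $\mathcal{B}$ is a bornology on $X$, and $\mathbf{b}$ is a coarse proximity on $X$, i.e. a relation on the power set of $X$ such that for all $A,B,C\subseteq X$ (with $\bar{\mathbf{b}}$ denoting the negation of $\mathbf{b}$): (i) $A\,\mathbf{b}\,B$ implies $B\,\mathbf{b}\,A$; (ii) $(A\cup B)\,\mathbf{b}\,C$ iff $A\,\mathbf{b}\,C$ or $B\,\mathbf{b}\,C$; (iii) $A\,\mathbf{b}\,B$ implies $A\notin\mathcal{B}$ and $B\notin\mathcal{B}$; (iv) $A\,\bar{\mathbf{b}}\,B$ implies that there exists $E\subseteq X$ such that $A\,\bar{\mathbf{b}}\,E$ and $(X\setminus E)\,\bar{\mathbf{b}}\,B$;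 (v) $A\cap B\notin\mathcal{B}$ implies $A\,\mathbf{b}\,B$. A weak asymptotic resemblance on a set $X$ is an equivalence relation $\phi$ on the power set $2^X$ such that $A\,\phi\,B$ and $C\,\phi\,D$ imply $(A\cup C)\,\phi\,(B\cup D)$. *)

(* Defs.v *)
From Corelib Require Import RelationClasses.
From mathcomp Require Import all_boot.
From mathcomp Require Import boolp classical_sets.

Set Implicit Arguments.
Unset Strict Implicit.
Unset Printing Implicit Defensive.

Local Open Scope classical_set_scope.

Record bornology (X : Type) (B : set (set X)) : Prop := Bornology {
  bornology_set1 : forall x : X, B [set x];
  bornology_subset : forall A C : set X, B A -> C `<=` A -> B C;
  bornology_setU : forall A C : set X, B A -> B C -> B (A `|` C)
}.

Record coarse_proximity (X : Type) (B : set (set X))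
    (b : set X -> set X -> Prop) : Prop := CoarseProximity {
  cprox_sym : forall A C : set X, b A C -> b C A;
  cprox_setU : forall A C D : set X, b (A `|` C) D <-> b A D \/ b C D;
  cprox_unbounded : forall A C : set X, b A C -> ~ B A /\ ~ B C;
  cprox_strong : forall A C : set X, ~ b A C ->
    exists E : set X, ~ b A E /\ ~ b (~` E) C;
  cprox_setI : forall A C : set X, ~ B (A `&` C) -> b A C
}.

Record coarse_proximity_space (X : Type) (B : set (set X))
    (b : set X -> set X -> Prop) : Prop := CoarseProximitySpace {
  cpspace_bornology : bornology B;
  cpspace_proximity : coarse_proximity B b
}.

Record weak_asymptotic_resemblance (X : Type)
    (phi : set X -> set X -> Prop) : Prop := WeakAsymptoticResemblance {
  war_equivalence : Equivalence phi;
  war_setU : forall A B C D : set X,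
    phi A B -> phi C D -> phi (A `|` C) (B `|` D)
}.

Definition cprox_resemblance (X : Type) (B : set (set X))
    (b : set X -> set X -> Prop) (A C : set X) : Prop :=
  (forall C' : set X, C' `<=` C -> ~ B C' -> b A C') /\
  (forall A' : set X, A' `<=` A -> ~ B A' -> b A' C).

(* Main.v *)
(** The relation splits as [dominates A C /\ dominates C A], so it is enough
    that [dominates] is a preorder compatible with unions.  For transitivity
    along [A], [C], [D]: if [A] were far from an unbounded [D' `<=` D], the
    strong axiom would give [E] far from [A] whose complement is far from [D'].
    As [C] is close to [D'], so is [C `&` E]; hence [C `&` E] is an unbounded
    part of [C], so it is close to [A], contradicting that [E] is far from
    [A]. *)

Require Import Defs.
From mathcomp Require Import all_boot.
From mathcomp Require Import boolp classical_sets.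

Local Open Scope classical_set_scope.

Definition dominates {X : Type} (B : set (set X))
    (b : set X -> set X -> Prop) (A C : set X) : Prop :=
  forall C' : set X, C' `<=` C -> ~ B C' -> b A C'.

Section CoarseProximity.
Context {X : Type} {B : set (set X)} {b : set X -> set X -> Prop}.
Hypothesis hb : coarse_proximity B b.

Lemma cprox_subl {A C D : set X} : A `<=` C -> b A D -> b C D.
Proof. by move=> /setUidPr <- bAD; apply/(cprox_setU hb); left. Qed.

Lemma cprox_subr {A C D : set X} : C `<=` D -> b A C -> b A D.
Proof.
by move=> CD /(cprox_sym hb) bCA; apply/(cprox_sym hb)/(cprox_subl CD).
Qed.

(** Symmetry of [b] turns the second clause of the resemblance into the first one with the arguments
    exchanged. *)
Lemma cprox_resemblanceE {A C : set X} :
  cprox_resemblance B b A C <-> dominates B b A C /\ dominates B b C A.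
Proof.
by split=> -[AC CA]; split=> // S SA uS; apply: (cprox_sym hb); apply: CA.
Qed.

(** An unbounded part of [A] is its own intersection with [A], so the intersection axiom applies. *)
Lemma dominates_refl (A : set X) : dominates B b A A.
Proof. by move=> S /setIidPr AS uS; apply: (cprox_setI hb); rewrite AS. Qed.

Lemma dominates_trans {A C D : set X} :
  dominates B b A C -> dominates B b C D -> dominates B b A D.
Proof.
move=> AC CD S SD uS; apply: contrapT => /(cprox_strong hb)[E [nAE nES]].
have := CD S SD uS; rewrite -(setUIDK C E) => /(cprox_setU hb)[bCES|bCES].
- have [uCE _] := cprox_unbounded hb bCES.
  apply: nAE; apply: (@cprox_subr _ (C `&` E)); first exact: subIsetr.
  by apply: AC uCE; apply: subIsetl.
- by apply: nES; apply: cprox_subl bCES => x [].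
Qed.

(** Bounded sets are closed under union, so an unbounded [S] inside the union has an unbounded trace
    on [C] or on [E]; closeness to that trace passes up to [S]. *)
Lemma dominates_setU (hB : bornology B) (A C D E : set X) :
  dominates B b A C -> dominates B b D E ->
  dominates B b (A `|` D) (C `|` E).
Proof.
move=> AC DE S SCE uS.
have [bSC|uSC] := pselect (B (S `&` C)).
- have uSE : ~ B (S `&` E).
    move=> bSE; apply: uS; rewrite -(setIidPl S (C `|` E)).2 ?setIUr //.
    exact: (bornology_setU hB).
  apply: (@cprox_subl D); first exact: subsetUr.
  apply: (@cprox_subr _ (S `&` E)); first exact: subIsetl.
  by apply: DE uSE; apply: subIsetr.
- apply: (@cprox_subl A); first exact: subsetUl.
  apply: (@cprox_subr _ (S `&` C)); first exact: subIsetl.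
  by apply: AC uSC; apply: subIsetr.
Qed.

End CoarseProximity.

Theorem theorem6p8 (X : Type) (B : set (set X)) (b : set X -> set X -> Prop)
    (hX : coarse_proximity_space B b) :
  weak_asymptotic_resemblance (cprox_resemblance B b).
Proof.
have [hB hb] := hX; split; first split.
- by move=> A; apply/(cprox_resemblanceE hb); split; apply: dominates_refl.
- by move=> A C /(cprox_resemblanceE hb)[AC CA]; apply/(cprox_resemblanceE hb).
- move=> A C D /(cprox_resemblanceE hb)[AC CA] /(cprox_resemblanceE hb)[CD DC].
  by apply/(cprox_resemblanceE hb); split; apply: (@dominates_trans _ _ _ hb _ C).
- move=> A C D E /(cprox_resemblanceE hb)[AC CA].
  move=> /(cprox_resemblanceE hb)[DE ED].
  by apply/(cprox_resemblanceE hb); split; apply: dominates_setU.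
Qed.
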